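(* Let $G$ be any one of the following graphs: the $3$-dimensional hypercube graph $Q_3$, the $4$-dimensional hypercube graph $Q_4$, or the Petersen graph. In the unbiased Picker-Chooser game played on $E(G)$, Picker (acting as Maker) has a strategy which guarantees, against every play of Chooser, that at the end of the game at least one vertex of $G$ is isolated in Chooser's subgraph, i.e. there is a vertex all of whose incident edges in $G$ belong to Picker.
   Context: Picker-Chooser (also called Waiter-Client) game on the edge set of a graph $G$: in each turn Picker selects a pair of previously unclaimed edges of $G$ and offers them to Chooser. Chooser claims exactly one of the two edges for Chooser's subgraph, and the other edge is allocated to Picker's subgraph. This continues until all edges of $G$ are claimed; if the total number of edges is odd, the final remaining single edge is automatically assigned to Chooser. In the Picker-Chooser version Picker plays as Maker (attacker) and Chooser as Breaker (defender). The $n$-dimensional hypercube graph $Q_n$ has vertex set $\{0,1\}^n$, with two vertices adjacent if and only if they differ in exactly one coordinate. *)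

(* Defs.v *)
From mathcomp Require Import all_boot.

Set Implicit Arguments.
Unset Strict Implicit.
Unset Printing Implicit Defensive.

Record sgraph := SGraph {
  svertex :> finType;
  sadj : rel svertex;
  sadj_sym : symmetric sadj;
  sadj_irrefl : irreflexive sadj
}.

Definition edges (G : sgraph) : {set {set G}} :=
  [set [set p.1; p.2] | p : G * G & sadj p.1 p.2].

Section Hypercube.
Variable n : nat.

Definition hamming (x y : n.-tuple bool) : nat :=
  #|[set i : 'I_n | tnth x i != tnth y i]|.

Definition cube_adj : rel (n.-tuple bool) := fun x y => hamming x y == 1.

Lemma cube_adj_sym : symmetric cube_adj.
Proof.
move=> x y; rewrite /cube_adj /hamming; congr (_ == _).
by apply: eq_card => i; rewrite !inE eq_sym.
Qed.

Lemma cube_adj_irrefl : irreflexive cube_adj.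
Proof.
move=> x; rewrite /cube_adj /hamming (_ : [set _ | _] = set0) ?cards0 //.
by apply/setP => i; rewrite !inE eqxx.
Qed.

Definition hypercube : sgraph := SGraph cube_adj_sym cube_adj_irrefl.

End Hypercube.

(* The Petersen graph as the Kneser graph K(5,2): vertices are the 2-subsets   *)
(* of a 5-set, adjacent when disjoint.                                        *)
Definition pair5 : finType := {A : {set 'I_5} | #|A| == 2}.

Definition petersen_adj : rel pair5 := fun A B => [disjoint val A & val B].

Lemma petersen_adj_sym : symmetric petersen_adj.
Proof. by move=> A B; rewrite /petersen_adj disjoint_sym. Qed.

Lemma petersen_adj_irrefl : irreflexive petersen_adj.
Proof.
move=> A; apply/negbTE; rewrite /petersen_adj -setI_eq0 setIid -cards_eq0.
by rewrite (eqP (valP A)).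
Qed.

Definition petersen : sgraph := SGraph petersen_adj_sym petersen_adj_irrefl.

Section PickerChooser.
Variable G : sgraph.

(* The history of a play lists its turns in chronological order; a turn        *)
(* (c, p) records that {c, p} was offered, Chooser claimed c and Picker got p. *)
Definition history : Type := seq ({set G} * {set G}).

Definition chosen (h : history) : {set {set G}} := [set e in unzip1 h].
Definition picked (h : history) : {set {set G}} := [set e in unzip2 h].

Definition unclaimed (h : history) : {set {set G}} :=
  edges G :\: (chosen h :|: picked h).

(* No pair is left to offer: at most one edge is unclaimed.                    *)
Definition finished (h : history) : bool := #|unclaimed h| <= 1.

(* The order of the two components of an offer carries no meaning.             *)
Definition picker_strategy : Type := history -> {set G} * {set G}.

(* The histories that can arise when Picker follows S and Chooser chooses      *)
(* freely.                                                                     *)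
Inductive play (S : picker_strategy) : history -> Prop :=
| play_start : play S [::]
| play_turn (h : history) (c p : {set G}) :
    play S h -> ~~ finished h -> S h = (c, p) \/ S h = (p, c) ->
    play S (rcons h (c, p)).

(* Legality is required along the plays of S only; each turn then claims two   *)
(* new edges, so every play of a legal S can be continued to a finished one.   *)
Definition legal (S : picker_strategy) : Prop :=
  forall h, play S h -> ~~ finished h ->
    [/\ (S h).1 \in unclaimed h, (S h).2 \in unclaimed h
      & (S h).1 != (S h).2].

(* For a finished h, a last single unclaimed edge goes to Chooser.             *)
Definition chooser_graph (h : history) : {set {set G}} :=
  chosen h :|: unclaimed h.

Definition isolated (F : {set {set G}}) (v : G) : bool :=
  [forall e in F, v \notin e].

Definition picker_can_isolate : Prop :=
  exists2 S : picker_strategy, legal S &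
    forall h, play S h -> finished h ->
      exists v : G, isolated (chooser_graph h) v.

End PickerChooser.

(* Main.v *)
Require Import Defs.
From mathcomp Require Import all_boot.

Set Implicit Arguments.
Unset Strict Implicit.
Unset Printing Implicit Defensive.

(** Call a vertex live while Chooser owns none of its edges, and give a live
    vertex with k unclaimed edges the weight 2^-k, the probability that Picker
    gets all of them if Chooser flips coins.  The total weight is 8/8 = 1 for
    Q_3, 16/16 = 1 for Q_4 and 10/8 for the Petersen graph, and Picker wins as
    soon as some live vertex has no unclaimed edge left.  Give an edge the sum
    of the weights of its live ends.  When Chooser takes c and Picker receives
    p, the total drops by the weight of c and, if no live vertex meets both,
    grows by the weight of p.  So an offer of two edges of equal weight without
    a common live end preserves the total whatever Chooser answers; Picker
    makes only such balanced offers.  On the cubes there is no other way: an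
    offer of another kind lets Chooser bring the total below 1, and Chooser can
    then keep it below 1 to the end.

    The only danger is a shortage of balanced offers, as when two live vertices
    are left whose only unclaimed edge joins them.  It is avoided by offering
    first the edges whose two ends are live and have many unclaimed edges,
    which removes the shared edges while balanced partners are plentiful.
    On Q_4, Picker can for instance first offer the eight edges of one
    direction, paired along a second direction: eight live vertices of weight
    1/8 remain, four in each of two disjoint copies of Q_3.  In each copy three
    more balanced offers leave one live vertex with one unclaimed edge, and the
    offer of these two edges wins.

    The play is short enough that the rule can be checked exhaustively.
    [search] explores the balanced offers in that order, on stars written as
    lists of coded edges; [search_winning] turns its success into a win from
    the corresponding history of the game, and [winning_can_isolate] extracts
    a strategy from wins of histories.  [search_can_isolate] applies both to a
    graph whose vertices and adjacency are given by computable codes: bit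
    sequences for the cubes, ordered pairs of numbers for the Petersen graph. *)

(** * From winning histories to a strategy *)

Section WinningHistories.
Variable G : sgraph.
Implicit Types (h : history G) (o : {set G} * {set G}) (v : G).

Definition swap o := (o.2, o.1).

Definition legal_offer h o : bool :=
  [&& o.1 \in unclaimed h, o.2 \in unclaimed h & o.1 != o.2].

(** Unlike the isolation of a vertex in Chooser's final graph, this property
    makes sense in the middle of a play, and it persists. *)
Definition star_picked h : bool :=
  [exists v, [forall e in edges G, (v \in e) ==> (e \in picked h)]].

(** Picker can own a whole star within the next [n] turns.  The answer of
    Chooser to the offer [o] yields one of the turns [o] and [swap o]. *)
Fixpoint winning n h : bool :=
  star_picked h ||
  if n is m.+1 then
    [exists o, [&& legal_offer h o, winning m (rcons h o)
                 & winning m (rcons h (swap o))]]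
  else false.

Lemma winning_star n h : star_picked h -> winning n h.
Proof. by case: n => [|n] /= ->. Qed.

Lemma chosen_rcons h o : chosen (rcons h o) = o.1 |: chosen h.
Proof.
by apply/setP => e; rewrite !inE /unzip1 map_rcons mem_rcons inE.
Qed.

Lemma picked_rcons h o : picked (rcons h o) = o.2 |: picked h.
Proof.
by apply/setP => e; rewrite !inE /unzip2 map_rcons mem_rcons inE.
Qed.

Lemma mem_unclaimed h e :
  (e \in unclaimed h)
    = [&& e \in edges G, e \notin chosen h & e \notin picked h].
Proof. by rewrite /unclaimed in_setD in_setU negb_or andbC. Qed.

Lemma mem_unclaimed_rcons h o e :
  (e \in unclaimed (rcons h o))
    = [&& e != o.1, e != o.2 & e \in unclaimed h].
Proof.
rewrite !mem_unclaimed chosen_rcons picked_rcons !in_setU1 !negb_or.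
by case: (e == o.1); case: (e == o.2); rewrite /= ?andbF.
Qed.

Lemma star_picked_rcons h o : star_picked h -> star_picked (rcons h o).
Proof.
case/existsP=> v /forall_inP hv; apply/existsP; exists v.
apply/forall_inP=> e eE; apply/implyP=> ve.
by rewrite picked_rcons in_setU1 (implyP (hv e eE) ve) orbT.
Qed.

Lemma legal_offerP h : reflect (exists o, legal_offer h o) (~~ finished h).
Proof.
rewrite /finished -ltnNge; apply: (iffP card_gt1P) => [[e [f []]]|[[e f]]].
  by move=> he hf ef; exists (e, f); rewrite /legal_offer he hf.
by case/and3P=> he hf ef; exists e, f.
Qed.

Definition keeps_winning n h o : bool :=
  [&& legal_offer h o, winning n (rcons h o) & winning n (rcons h (swap o))].

(** A history of length [k] has [n - k] turns left to win.  After the win, any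
    two unclaimed edges are offered, since the play goes on until all edges are
    claimed. *)
Definition winning_strategy n : picker_strategy G := fun h =>
  if [pick o | keeps_winning (n - (size h).+1) h o] is Some o then o
  else odflt (set0, set0) [pick o | legal_offer h o].

Lemma winning_strategy_legal n h :
  ~~ finished h -> legal_offer h (winning_strategy n h).
Proof.
move=> /legal_offerP [o0 ho0]; rewrite /winning_strategy.
case: pickP => [o /and3P[] //|_]; case: pickP => //= none.
by rewrite none in ho0.
Qed.

(** Besides the win, the induction carries the facts that turn a star owned by
    Picker into an isolated vertex: Chooser owns only edges of the graph, and
    none of Picker's. *)
Lemma winning_strategy_play n h : winning n [::] ->
  play (winning_strategy n) h ->
  [/\ chosen h \subset edges G, [disjoint chosen h & picked h]
    & winning (n - size h) h].
Proof.
move=> win0; elim=> [|{}h c p _ [sub dis win] nfin move_h].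
  have -> : chosen [::] = set0 :> {set {set G}}.
    by apply/setP => e; rewrite !inE.
  by rewrite sub0set subn0; split=> //; rewrite -setI_eq0 set0I.
have := winning_strategy_legal n nfin; set o := winning_strategy n h.
rewrite /legal_offer => /and3P[o1 o2 o12].
have [cU pU cp] : [/\ c \in unclaimed h, p \in unclaimed h & c != p].
  by case: move_h; rewrite -/o => oE; move: o1 o2 o12; rewrite oE /= // eq_sym.
split.
- rewrite chosen_rcons subUset sub1set sub andbT.
  by move: cU; rewrite mem_unclaimed => /andP[].
- rewrite chosen_rcons picked_rcons /=; apply/pred0P => e /=.
  rewrite !in_setU1; apply/negbTE.
  move: cU pU; rewrite !mem_unclaimed => /and3P[_ _ cP] /and3P[_ pC _].
  apply/andP => -[/orP[/eqP->|eC] /orP[/eqP eE|eP]].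
  + by rewrite eE eqxx in cp.
  + by rewrite eP in cP.
  + by rewrite -eE eC in pC.
  + by have := disjointFr dis eC; rewrite eP.
- case: (boolP (star_picked h)) => [st|nst].
    exact/winning_star/star_picked_rcons.
  rewrite size_rcons; move: win; rewrite subnS.
  case E: (n - size h) => [|m] /=; rewrite (negbTE nst) //=.
  case/existsP=> o' ho'.
  have : keeps_winning m h o.
    rewrite /o /winning_strategy subnS E /=.
    by case: pickP => // none; move: (none o'); rewrite /keeps_winning ho'.
  by case/and3P=> _; case: move_h; rewrite -/o => ->.
Qed.

(** A finished history admits no legal offer, so there a win can only be a star
    that Picker owns already. *)
Lemma winning_can_isolate n : winning n [::] -> picker_can_isolate G.
Proof.
move=> win0; exists (winning_strategy n) => [h _ nfin|h ph fin].
  exact/and3P/winning_strategy_legal.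
have [sub dis win] := winning_strategy_play win0 ph.
have : star_picked h.
  have noffer o : legal_offer h o = false.
    by apply/negbTE/negP => ho; move/legal_offerP: fin; apply; exists o.
  case: (n - size h) win => [|m] /=; first by rewrite orbF.
  by case/orP=> // /existsP[o]; rewrite noffer.
case/existsP=> v /forall_inP hv; exists v; apply/forall_inP=> e.
rewrite in_setU => eF; apply/negP => ve.
have pe : e \in edges G -> e \in picked h by move=> eE; apply: (implyP (hv e eE)).
case/orP: eF => [eC|].
  by have := disjointFr dis eC; rewrite pe // (subsetP sub).
by rewrite mem_unclaimed => /and3P[/pe->].
Qed.

End WinningHistories.

(** * Search among balanced offers *)

Section Search.
Variable T : eqType.
Implicit Types (F : seq (seq T)) (x c p : T) (o : T * T).

(** A position is the list [F] of the live stars, each reduced to its unclaimed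
    edges: the edge [c] of Chooser kills the stars through it, the edge [p] of
    Picker shortens those through it. *)
Definition claim c p F : seq (seq T) :=
  [seq filter (predC1 p) s | s <- F & c \notin s].

Definition sizes_at F x : seq nat := [seq size s | s <- F & x \in s].

(** The total of 2^-k over the live stars through [x], scaled by 2^d to stay in
    the integers, with [d] the largest size of a star of the position. *)
Definition weight F x : nat :=
  let d := foldr maxn 0 [seq size s | s <- F] in
  sumn [seq 2 ^ (d - k) | k <- sizes_at F x].

Fixpoint pairs (s : seq T) : seq (T * T) :=
  if s is x :: s' then [seq (x, y) | y <- s'] ++ pairs s' else [::].

(** Edges with two live ends of large residual degree come first; this order
    does not affect soundness, only the size of the search. *)
Definition ranked F : seq T :=
  sort (fun x y => sumn (sizes_at F y) <= sumn (sizes_at F x))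
    (undup (flatten F)).

Definition offers F : seq (T * T) :=
  [seq o <- pairs (ranked F) | (weight F o.1 == weight F o.2)
    & all (fun s => ~~ ((o.1 \in s) && (o.2 \in s))) F].

Fixpoint search n F : bool :=
  ([::] \in F) ||
  if n is m.+1 then
    has (fun o => search m (claim o.1 o.2 F) && search m (claim o.2 o.1 F))
      (offers F)
  else false.

Lemma mem_pairs (s : seq T) o : o \in pairs s -> (o.1 \in s) && (o.2 \in s).
Proof.
elim: s => //= x s IHs; rewrite mem_cat => /orP[/mapP[y ys ->]|/IHs/andP[]].
  by rewrite /= !inE eqxx ys orbT.
by rewrite !inE => -> ->; rewrite !orbT.
Qed.

(** The two edges of an offer are distinct because an edge equal to both would
    make its own star contain both. *)
Lemma mem_offers F o : o \in offers F ->
  [/\ o.1 \in flatten F, o.2 \in flatten F & o.1 != o.2].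
Proof.
rewrite mem_filter -andbA => /and3P[_ /allP apart /mem_pairs].
rewrite !mem_sort !mem_undup => /andP[o1 o2]; split=> //.
apply/eqP => o12; case/flattenP: o1 => s sF o1s.
by have := apart s sF; rewrite -o12 o1s.
Qed.

Lemma mem_claim c p F s : s \in claim c p F ->
  exists2 s0, s0 \in F & s = filter (predC1 p) s0 /\ c \notin s0.
Proof.
by case/mapP=> s0; rewrite mem_filter => /andP[cs sF ->]; exists s0.
Qed.

Variables (G : sgraph) (code : T -> {set G}).

Definition surrounds h (s : seq T) (v : G) : Prop :=
  forall e, e \in edges G -> v \in e -> e \notin picked h ->
    e \in [seq code x | x <- s].

(** The list [F] may omit live stars, but a star in it must list every edge that
    Picker still needs at some vertex, and only unclaimed ones. *)
Definition models h F : Prop :=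
  [/\ {in flatten F &, injective code},
      {in flatten F, forall x, code x \in unclaimed h}
    & {in F, forall s, exists v, surrounds h s v}].

Lemma models_claim h F c p : models h F ->
    c \in flatten F -> p \in flatten F ->
  models (rcons h (code c, code p)) (claim c p F).
Proof.
case=> inj free surr cF pF.
have sub x : x \in flatten (claim c p F) ->
    [/\ x \in flatten F, x != c & x != p].
  case/flattenP=> s /mem_claim[s0 s0F [-> cs]].
  rewrite mem_filter => /andP[/= xp xs]; split=> //.
    by apply/flattenP; exists s0.
  by apply: contraNneq cs => <-.
split=> [x y /sub[xF _ _] /sub[yF _ _]|x /sub[xF xc xp]|s].
- exact: inj.
- by rewrite mem_unclaimed_rcons /= free // !(inj_in_eq inj) ?xc ?xp.
- case/mem_claim=> s0 s0F [-> _]; have [v hv] := surr s0 s0F; exists v.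
  move=> e eE ve; rewrite picked_rcons in_setU1 negb_or => /andP[/= ep nP].
  have /mapP[x xs eE'] := hv e eE ve nP; apply/mapP; exists x => //.
  by rewrite mem_filter xs andbT /=; apply: contraNneq ep => <-; rewrite eE'.
Qed.

Lemma search_winning n h F : models h F -> search n F -> winning n h.
Proof.
have base h' F' : models h' F' -> [::] \in F' -> star_picked h'.
  case=> _ _ surr nilF; have [v hv] := surr _ nilF.
  apply/existsP; exists v; apply/forall_inP=> e eE; apply/implyP=> ve.
  by apply: contraT => /(hv e eE ve).
elim: n h F => [|n IHn] h F mod; first by rewrite /= !orbF; apply: base mod.
case/orP=> [/(base _ _ mod)|]; first exact: winning_star.
case/hasP=> o /mem_offers[o1 o2 o12] /andP[win1 win2].
have [inj free _] := mod.
apply/orP; right; apply/existsP; exists (code o.1, code o.2).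
rewrite /legal_offer /= !free //= (inj_in_eq inj) // o12 /=.
by apply/andP; split; [apply: IHn (models_claim mod o1 o2) win1
                      | apply: IHn (models_claim mod o2 o1) win2].
Qed.

End Search.

(** * Graphs given by computable codes *)

Section Model.
Variables (K : eqType) (vs : seq K) (adj : rel K).

(** An edge needs the same code at both of its ends. *)
Definition orient x y : K * K :=
  if index x vs < index y vs then (x, y) else (y, x).

Definition star x : seq (K * K) := [seq orient x y | y <- vs & adj x y].

Definition stars : seq (seq (K * K)) := [seq star x | x <- vs].

Variables (G : sgraph) (f : K -> G).
Hypothesis f_inj : {in vs &, injective f}.
Hypothesis f_onto : forall v, exists2 x, x \in vs & f x = v.
Hypothesis f_adj : {in vs &, forall x y, sadj (f x) (f y) = adj x y}.

Definition edge_of (k : K * K) : {set G} := [set f k.1; f k.2].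

Lemma edge_of_orient x y : edge_of (orient x y) = [set f x; f y].
Proof. by rewrite /orient; case: ifP => //= _; rewrite /edge_of setUC. Qed.

Lemma orientC x y : x \in vs -> orient x y = orient y x.
Proof.
move=> xvs; rewrite /orient; case: ltngtP => // exy.
have yvs : y \in vs by rewrite -index_mem -exy index_mem.
by rewrite -(nth_index x xvs) exy nth_index.
Qed.

Lemma mem_stars k : k \in flatten stars ->
  exists x y, [/\ x \in vs, y \in vs, adj x y & k = orient x y].
Proof.
case/flattenP=> s /mapP[x xvs ->] /mapP[y].
by rewrite mem_filter => /andP[xy yvs] ->; exists x, y.
Qed.

Lemma stars_model : models edge_of [::] stars.
Proof.
split=> [k l /mem_stars[x [y [xvs yvs _ ->]]] /mem_stars[z [t [zvs tvs _ ->]]]|k|].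
- rewrite !edge_of_orient => /setP eq_e.
  have [mx my] : f x \in [set f z; f t] /\ f y \in [set f z; f t].
    by rewrite -!eq_e !inE !eqxx orbT.
  have [mz mt] : f z \in [set f x; f y] /\ f t \in [set f x; f y].
    by rewrite !eq_e !inE !eqxx orbT.
  move: mx my mz mt; rewrite !inE !(inj_in_eq f_inj) //.
  case/orP=> /eqP exz; case/orP=> /eqP eyt; rewrite ?exz ?eyt ?eqxx ?orbT ?orbF //=.
  + by move=> _ /orP[] /eqP ->.
  + by move=> _ _; rewrite orientC.
  + by move=> /orP[] /eqP -> _.
- case/mem_stars=> x [y [xvs yvs xy ->]].
  rewrite mem_unclaimed edge_of_orient !inE /= andbT.
  by apply/imsetP; exists (f x, f y); rewrite // inE /= f_adj.
- move=> s /mapP[x xvs ->]; exists (f x) => e /imsetP[[v w]].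
  rewrite inE /= => vw -> {e} xe _.
  have [u xu ->] : exists2 u, sadj (f x) u & [set v; w] = [set f x; u].
    move: xe; rewrite !inE => /orP[] /eqP ->; first by exists w.
    by exists v; rewrite 1?sadj_sym // setUC.
  have [y yvs fy] := f_onto u; apply/mapP; exists (orient x y).
    by apply/mapP; exists y; rewrite // mem_filter yvs -f_adj // fy xu.
  by rewrite edge_of_orient fy.
Qed.

Lemma search_can_isolate n : search n stars -> picker_can_isolate G.
Proof. by move/(search_winning stars_model)/winning_can_isolate. Qed.

End Model.

(** * The hypercubes and the Petersen graph *)

Fixpoint bitseqs n : seq bitseq :=
  if n is m.+1 then [seq b :: s | b <- [:: false; true], s <- bitseqs m]
  else [:: [::]].

Definition differ_once (s t : bitseq) : bool :=
  count (fun b => b.1 != b.2) (zip s t) == 1.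

Lemma mem_bitseqs n s : (s \in bitseqs n) = (size s == n).
Proof.
elim: n s => [|n IHn] [|b s] //=.
  by rewrite cats0 mem_cat; apply/orP => -[] /mapP[].
rewrite cats0 mem_cat eqSS -IHn.
have cons_inj c : injective (cons c : bitseq -> bitseq) by move=> ? ? [].
case: b; last rewrite orbC; rewrite mem_map // ?orbF.
  by apply/orb_idl => /mapP[].
by apply/orb_idl => /mapP[].
Qed.

Lemma hamming_count n (x y : n.-tuple bool) :
  hamming x y = count (fun b => b.1 != b.2) (zip x y).
Proof.
rewrite /hamming cardsE cardE size_filter.
have -> : zip x y = [seq (tnth x i, tnth y i) | i <- enum 'I_n].
  by rewrite -zip_map !map_tnth_enum.
by rewrite enumT [RHS]count_map; apply: eq_count => i.
Qed.

Lemma cube_can_isolate n m :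
  search m (stars (bitseqs n) differ_once) -> picker_can_isolate (hypercube n).
Proof.
pose f s : hypercube n := insubd [tuple of nseq n false] s.
have fE s : s \in bitseqs n -> tval (f s) = s.
  by rewrite mem_bitseqs => sn; rewrite [LHS]val_insubd sn.
apply: (@search_can_isolate _ _ _ _ f) => [s t sn tn /(congr1 val)|v|s t sn tn].
- by rewrite /= !fE.
- exists (tval v); first by rewrite mem_bitseqs size_tuple.
  by apply: val_inj; rewrite /= fE // mem_bitseqs size_tuple.
- by rewrite /sadj /= /cube_adj hamming_count !fE.
Qed.

Definition pairs5 : seq (nat * nat) := pairs (iota 0 5).

Definition disjoint_pairs (a b : nat * nat) : bool :=
  [&& a.1 != b.1, a.1 != b.2, a.2 != b.1 & a.2 != b.2].

Lemma petersen_can_isolate m :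
  search m (stars pairs5 disjoint_pairs) -> picker_can_isolate petersen.
Proof.
pose g (a : nat * nat) : {set 'I_5} := [set inord a.1; inord a.2].
have lt5 a : a \in pairs5 -> (a.1 < a.2) && (a.2 < 5).
  by move: a; apply/allP.
have pairs5P i j : i < j < 5 -> (i, j) \in pairs5.
  case/andP=> ij j5; case: j j5 ij => [|[|[|[|[|j]]]]] // _;
  by case: i => [|[|[|[|i]]]].
have g2 a : a \in pairs5 -> #|g a| == 2.
  case/lt5/andP=> a12 a2; rewrite cards2 -val_eqE /= !inordK //.
    by rewrite neq_ltn a12.
  exact: ltn_trans a2.
pose A0 : pair5 := exist _ (g (0, 1)) (g2 (0, 1) isT).
pose f a : petersen := insubd A0 (g a).
have fE a : a \in pairs5 -> val (f a) = g a.
  by move=> aP; rewrite val_insubd g2.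
have mem_g a i : a \in pairs5 -> (i \in g a) = (val i \in [:: a.1; a.2]).
  case/lt5/andP=> a12 a2; rewrite !inE -!val_eqE /= !inordK //.
  exact: ltn_trans a2.
apply: (@search_can_isolate _ _ _ _ f).
- move=> a b aP bP /(congr1 val); rewrite !fE // => /setP eqg.
  (* A pair of numbers below 5 in increasing order is determined by which *)
  (* numbers belong to it: a check over all the codes. *)
  have sep : {in pairs5 &, forall a b : nat * nat,
      all (fun i => (i \in [:: a.1; a.2]) == (i \in [:: b.1; b.2])) (iota 0 5)
        -> a = b}.
    move=> {aP bP eqg}a {}b aP bP sab; apply/eqP; move: sab; apply/implyP.
    by move: b bP; apply/allP; move: a aP; apply/allP.
  apply: sep => //; apply/allP => i; rewrite mem_iota => /= i5.
  by have := eqg (Ordinal i5); rewrite !mem_g //= => ->.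
- move=> v; have /cards2P[i [j [ij vE]]] := valP v.
  wlog lt_ij : i j ij vE / i < j.
    move=> IH; case: (ltngtP i j) => [|ji|/val_inj eij]; first exact: IH.
      by apply: (IH j i); rewrite // 1?eq_sym // setUC.
    by rewrite eij eqxx in ij.
  have aP : (val i, val j) \in pairs5 by rewrite pairs5P // lt_ij ltn_ord.
  exists (val i, val j) => //; apply: val_inj.
  by rewrite fE // /g /= !inord_val vE.
- move=> a b aP bP; rewrite /sadj /= /petersen_adj !fE //.
  have [/andP[a12 a2] /andP[b12 b2]] := (lt5 a aP, lt5 b bP).
  rewrite disjoints_subset subUset !sub1set !in_setC !mem_g //= !inE !inordK //.
    by rewrite !negb_or -andbA.
  exact: ltn_trans a2.
Qed.

Theorem mainTheorem7 :
  [/\ picker_can_isolate (hypercube 3),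
      picker_can_isolate (hypercube 4)
    & picker_can_isolate petersen].
Proof.
(* The numbers bound the turns that the search may spend; a tighter bound can *)
(* reject the first win found and so lengthen the search. *)
(* Lazy evaluation matters: call by value would explore both operands of *)
(* every boolean connective, hence the whole tree of offers. *)
split.
- by apply: (@cube_can_isolate _ 6); lazy.
- by apply: (@cube_can_isolate _ 12); lazy.
- by apply: (@petersen_can_isolate 7); lazy.
Qed.
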